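(* Let $G$ be a finitely generated group with a finite symmetric generating set $S$, let $X$ be a metric space in which every closed ball is compact, and let $\Phi\in Act(G,X)$. If $\Phi$ is expansive and has the shadowing property, then $\Phi$ is strongly $GH$-stable.
   Context: Here $Act(G,X)$ is the set of uniformly continuous actions of $G$ on a metric space $(X,d_X)$: maps $\Phi:G\times X\to X$ such that, writing $\Phi_g=\Phi(g,\cdot)$, one has $\Phi_e=\mathrm{id}_X$, $\Phi_{gh}=\Phi_g\circ\Phi_h$ for all $g,h\in G$, and each $\Phi_g$ is a homeomorphism with $\Phi_g$ and $\Phi_{g^{-1}}$ uniformly continuous. Expansive: there is $\mathfrak e>0$ such that for all $x\ne y$ in $X$ there is $g\in G$ with $d_X(\Phi_g(x),\Phi_g(y))>\mathfrak e$. Shadowing property (with respect to $S$): for every $\epsilon>0$ there is $\delta>0$ such that for every map $f:G\to X$ with $d_X(\Phi_s(f(g)),f(sg))<\delta$ for all $s\in S$, $g\in G$ (a $\delta$-pseudo orbit) there is $x\in X$ with $d_X(\Phi_g(x),f(g))<\epsilon$ for all $g\in G$. For a metric space $(X,d_X)$ put $d^X(x,y)=\min\{d_X(x,y),1\}$. For $A,B\subset X$ let $d^X(A,B)=\inf\{d^X(a,b):a\in A,b\in B\}$ and $d^X_H(A,B)=\max\{\sup_{a\in A}d^X(a,B),\sup_{b\in B}d^X(A,b)\}$. For $\delta>0$, a (not necessarily continuous) map $i:Y\to X$ between metric spaces is a $\delta$-isometry if $\max\{d^X_H(i(Y),X),\ \sup_{y_1,y_2\in Y}|d^X(i(y_1),i(y_2))-d^Y(y_1,y_2)|\}<\delta$.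 For $\Phi\in Act(G,X)$, $\Psi\in Act(G,Y)$ and a (not necessarily continuous) map $i:Y\to X$, let $d_S^X(\Phi\circ i,i\circ\Psi)=\sup_{(s,y)\in S\times Y}d^X(\Phi_s(i(y)),i(\Psi_s(y)))$, and define $$\overline d^{S}_{GH}(\Phi,\Psi)=\inf\{\delta>0:\text{ there is a }\delta\text{-isometry } i:Y\to X \text{ with } d_S^X(\Phi\circ i,i\circ\Psi)<\delta\}.$$ $\Phi\in Act(G,X)$ is strongly $GH$-stable (with respect to $S$) if for every $\epsilon>0$ there is $\delta>0$ such that for every metric space $Y$ and every $\Psi\in Act(G,Y)$ with $\overline d^{S}_{GH}(\Phi,\Psi)<\delta$ there is a continuous $\epsilon$-isometry $k:Y\to X$ with $\Phi_g\circ k=k\circ\Psi_g$ for all $g\in G$. *)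

(* Defs.v *)
From HB Require Import structures.
From mathcomp Require Import all_boot all_order all_algebra.
From mathcomp Require Import all_classical all_reals ereal topology.

Set Implicit Arguments.
Unset Strict Implicit.
Unset Printing Implicit Defensive.

Import Order.TTheory GRing.Theory Num.Theory.

Local Open Scope classical_set_scope.
Local Open Scope ring_scope.

Definition symmetric_subset (G : groupType) (S : set G) : Prop :=
  forall s, S s -> S (s^-1)%g.

(* The only subgroup of G containing S is G. *)
Definition generating (G : groupType) (S : set G) : Prop :=
  forall H : {pred G}, group_closed H -> (forall s, S s -> s \in H) ->
  forall g, g \in H.

(* The library's [closed_ball] is the closure of the open ball, which can be
   smaller than the set below. *)
Definition closed_balls_compact (R : realType) (X : metricType R) : Prop :=
  forall (x : X) (r : R), 0 < r -> compact [set y : X | mdist x y <= r].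

Definition homeomorphism (X Y : topologicalType) (f : X -> Y) : Prop :=
  continuous f /\
  exists h : Y -> X, [/\ continuous h, cancel f h & cancel h f].

Record Act (R : realType) (G : groupType) (X : metricType R) := MkAct {
  act :> G -> X -> X ;
  act1 : act 1%g = id ;
  actM : forall g h : G, act (g * h)%g = act g \o act h ;
  act_homeo : forall g, homeomorphism (act g) ;
  act_unif : forall g, unif_continuous (act g) /\ unif_continuous (act g^-1%g)
}.

Definition expansive (R : realType) (G : groupType) (X : metricType R)
    (Phi : Act G X) : Prop :=
  exists2 e : R, 0 < e &
    forall x y : X, x <> y -> exists g : G, e < mdist (Phi g x) (Phi g y).

Definition pseudo_orbit (R : realType) (G : groupType) (S : set G)
    (X : metricType R) (Phi : Act G X) (delta : R) (f : G -> X) : Prop :=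
  forall s g, S s -> mdist (Phi s (f g)) (f (s * g)%g) < delta.

Definition shadowing (R : realType) (G : groupType) (S : set G)
    (X : metricType R) (Phi : Act G X) : Prop :=
  forall eps : R, 0 < eps -> exists2 delta : R, 0 < delta &
    forall f : G -> X, pseudo_orbit S Phi delta f ->
    exists x : X, forall g, mdist (Phi g x) (f g) < eps.

Definition bdist (R : realType) (X : metricType R) (x y : X) : R :=
  Num.min (mdist x y) 1.

(* Suprema and infima are taken in the extended reals, so that
   the infimum of the empty set is +oo and its supremum is -oo. *)
Definition set_dist (R : realType) (X : metricType R) (A B : set X) : \bar R :=
  ereal_inf [set (bdist a b)%:E | a in A & b in B].

Definition hausdorff_dist (R : realType) (X : metricType R)
    (A B : set X) : \bar R :=
  maxe (ereal_sup [set set_dist [set a] B | a in A])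
       (ereal_sup [set set_dist A [set b] | b in B]).

Definition distortion (R : realType) (X Y : metricType R) (i : Y -> X) :
    \bar R :=
  ereal_sup
    [set `|bdist (i y.1) (i y.2) - bdist y.1 y.2|%:E | y in [set: Y * Y]].

Definition delta_isometry (R : realType) (X Y : metricType R) (delta : R)
    (i : Y -> X) : Prop :=
  (maxe (hausdorff_dist (range i) [set: X]) (distortion i) < delta%:E)%E.

Definition equivariance_defect (R : realType) (G : groupType) (S : set G)
    (X Y : metricType R) (Phi : Act G X) (Psi : Act G Y) (i : Y -> X) :
    \bar R :=
  ereal_sup [set (bdist (Phi sy.1 (i sy.2)) (i (Psi sy.1 sy.2)))%:E
            | sy in S `*` [set: Y]].

Definition GH_dist (R : realType) (G : groupType) (S : set G)
    (X Y : metricType R) (Phi : Act G X) (Psi : Act G Y) : \bar R :=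
  ereal_inf [set delta%:E | delta in [set delta : R | 0 < delta /\
    exists i : Y -> X, delta_isometry delta i /\
      (equivariance_defect S Phi Psi i < delta%:E)%E]].

Definition strongly_GH_stable (R : realType) (G : groupType) (S : set G)
    (X : metricType R) (Phi : Act G X) : Prop :=
  forall eps : R, 0 < eps -> exists2 delta : R, 0 < delta &
    forall (Y : metricType R) (Psi : Act G Y),
      (GH_dist S Phi Psi < delta%:E)%E ->
      exists k : Y -> X, [/\ continuous k, delta_isometry eps k &
        forall g : G, Phi g \o k = k \o Psi g].

(* Main.v *)
Require Import Defs.
From mathcomp Require Import all_boot all_order all_algebra.
From mathcomp Require Import all_classical all_reals ereal topology.
From mathcomp Require Import lra.

(** Fix an expansivity constant [e] of [Phi] and a small [eta].  An almost
    equivariant [delta]-isometry [i : Y -> X] sends every [Psi]-orbit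
    [g |-> Psi g y] to a pseudo orbit [g |-> i (Psi g y)] of [Phi], which is
    [eta]-shadowed by the orbit of some point [k y] of [X].

    Expansivity makes the shadowing point unique as soon as [2 eta <= e], and
    uniqueness gives equivariance: [Phi h (k y)] and [k (Psi h y)] both shadow
    the pseudo orbit of [Psi h y].  Taking [g = 1] in the shadowing estimate
    shows that [k] is uniformly [eta]-close to [i], so [k] is again an
    approximate isometry ([delta_isometry_perturb]).

    Continuity of [k], although [i] may be discontinuous, is where compact
    balls enter.  When [y'] tends to [y], each [Phi g (k y')] is eventually
    [e]-close to [Phi g (k y)], since [k] is close to [i], [i] distorts
    distances by little and [Psi g] is continuous.  Hence any cluster point of
    [k y'] has its whole orbit [e]-close to that of [k y], so it is [k y]; in
    a compact ball, having [k y] as only cluster point means converging to it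
    ([cvg_of_orbitwise_close]). *)

Set Implicit Arguments.
Unset Strict Implicit.
Unset Printing Implicit Defensive.

Import Order.TTheory GRing.Theory Num.Theory.

Local Open Scope classical_set_scope.
Local Open Scope ring_scope.

(** * The truncated distance *)

Lemma bdist_le_mdist (R : realType) (X : metricType R) (x y : X) :
  bdist x y <= mdist x y.
Proof. by rewrite /bdist ge_min lexx. Qed.

Lemma mdist_lt_of_bdist_lt (R : realType) (X : metricType R) (c : R) (x y : X) :
  c <= 1 -> bdist x y < c -> mdist x y < c.
Proof.
by rewrite /bdist gt_min => c1 /orP[//|/lt_le_trans/(_ c1)]; rewrite ltxx.
Qed.

Lemma bdist_lipschitz (R : realType) (X : metricType R) (x y x' y' : X) :
  `|bdist x y - bdist x' y'| <= mdist x x' + mdist y y'.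
Proof.
have min_le (x1 y1 x2 y2 : X) :
    bdist x1 y1 <= bdist x2 y2 + (mdist x1 x2 + mdist y1 y2).
  have := metric_triangle x1 x2 y1; have := metric_triangle x2 y2 y1.
  rewrite (metric_sym y2 y1); move: (mdist_ge0 x1 x2) (mdist_ge0 y1 y2).
  by rewrite /bdist; case: (leP (mdist x1 y1) 1); case: (leP (mdist x2 y2) 1);
    lra.
have := min_le x y x' y'; have := min_le x' y' x y.
rewrite (metric_sym x' x) (metric_sym y' y) ler_norml => ? ?.
by apply/andP; split; lra.
Qed.

(** * Approximate isometries *)

Lemma delta_isometry_dense (R : realType) (X Y : metricType R) (delta : R)
    (i : Y -> X) :
  delta_isometry delta i -> forall x, exists y, bdist (i y) x < delta.
Proof.
rewrite /delta_isometry gt_max => /andP[+ _] x.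
rewrite /hausdorff_dist gt_max => /andP[_ lt_delta].
have /ereal_inf_lt[_ [_ [y _ <-] [_ -> <-]]] :
    (set_dist (range i) [set x] < delta%:E)%E.
  by apply: le_lt_trans lt_delta; apply: ereal_sup_ubound; exists x.
by rewrite lte_fin; exists y.
Qed.

Lemma delta_isometry_distortion (R : realType) (X Y : metricType R) (delta : R)
    (i : Y -> X) :
  delta_isometry delta i ->
  forall y1 y2, `|bdist (i y1) (i y2) - bdist y1 y2| < delta.
Proof.
rewrite /delta_isometry gt_max => /andP[_ lt_delta] y1 y2.
rewrite -lte_fin; apply: le_lt_trans lt_delta.
by apply: ereal_sup_ubound; exists (y1, y2).
Qed.

(** The non-strict bound [c] is needed because suprema of quantities smaller
    than [delta] may reach [delta]. *)
Lemma delta_isometry_of_le (R : realType) (X Y : metricType R) (c delta : R)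
    (i : Y -> X) :
  0 <= c -> c < delta ->
  (forall x, exists y, bdist (i y) x <= c) ->
  (forall y1 y2, `|bdist (i y1) (i y2) - bdist y1 y2| <= c) ->
  delta_isometry delta i.
Proof.
move=> c0 cdelta dense dist_le.
suff : (maxe (hausdorff_dist (range i) [set: X]) (distortion i) <= c%:E)%E.
  by move=> /le_lt_trans; apply; rewrite lte_fin.
rewrite ge_max; apply/andP; split; last first.
  by apply/ereal_supP => _ [[y1 y2] _ <-]; rewrite lee_fin; exact: dist_le.
rewrite /hausdorff_dist ge_max; apply/andP; split.
  apply/ereal_supP => _ [x _ <-]; apply: ge_ereal_inf.
  exists (bdist x x)%:E; first by exists x => //; exists x.
  by rewrite lee_fin (le_trans (bdist_le_mdist _ _))// mdistxx.
apply/ereal_supP => _ [x _ <-]; apply: ge_ereal_inf.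
have [y iyx] := dense x.
exists (bdist (i y) x)%:E; last by rewrite lee_fin.
by exists (i y); [exists y|exists x].
Qed.

(** Moving each value by at most [eta] changes distances by at most
    [2 eta]. *)
Lemma delta_isometry_perturb (R : realType) (X Y : metricType R)
    (delta eta eps : R) (i k : Y -> X) :
  0 <= delta -> 0 <= eta -> delta + 2 * eta < eps ->
  delta_isometry delta i -> (forall y, mdist (k y) (i y) <= eta) ->
  delta_isometry eps k.
Proof.
move=> delta0 eta0 lt_eps iso close.
apply: (@delta_isometry_of_le _ _ _ (delta + 2 * eta)) => //.
- by lra.
- move=> x; have [y iyx] := delta_isometry_dense iso x; exists y.
  have := bdist_lipschitz (k y) x (i y) x; rewrite mdistxx ler_norml => /andP[_].
  by have := close y; lra.
- move=> y1 y2; have := bdist_lipschitz (k y1) (k y2) (i y1) (i y2).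
  have := delta_isometry_distortion iso y1 y2.
  rewrite ltr_norml !ler_norml => /andP[? ?] /andP[? ?].
  by have := close y1; have := close y2 => ? ?; apply/andP; split; lra.
Qed.

Lemma GH_dist_lt (R : realType) (G : groupType) (S : set G)
    (X Y : metricType R) (Phi : Act G X) (Psi : Act G Y) (delta : R) :
  (GH_dist S Phi Psi < delta%:E)%E ->
  exists d, exists2 i : Y -> X, 0 < d < delta /\ delta_isometry d i &
    forall s y, S s -> bdist (Phi s (i y)) (i (Psi s y)) < d.
Proof.
move=> /ereal_inf_lt[_ [d [d0 [i [iso defect]]] <-]].
rewrite lte_fin => d_lt; exists d, i; first by rewrite d0 d_lt.
move=> s y Ss; rewrite -lte_fin; apply: le_lt_trans defect.
by apply: ereal_sup_ubound; exists (s, y).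
Qed.

(** * Expansive actions *)

Definition expansivity_constant (R : realType) (G : groupType)
    (X : metricType R) (Phi : Act G X) (e : R) : Prop :=
  forall x y : X, (forall g, mdist (Phi g x) (Phi g y) <= e) -> x = y.

Lemma expansive_constant (R : realType) (G : groupType) (X : metricType R)
    (Phi : Act G X) :
  expansive Phi -> exists2 e, 0 < e & expansivity_constant Phi e.
Proof.
move=> [e e0 exp_e]; exists e => // x y close.
apply: contrapT => /exp_e[g]; rewrite ltNge; apply/negP; exact/negPn/close.
Qed.

Lemma shadowing_point_unique (R : realType) (G : groupType) (X : metricType R)
    (Phi : Act G X) (e eta : R) (f : G -> X) (x y : X) :
  expansivity_constant Phi e -> 2 * eta <= e ->
  (forall g, mdist (Phi g x) (f g) < eta) ->
  (forall g, mdist (Phi g y) (f g) < eta) -> x = y.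
Proof.
move=> exp_e eta_e shx shy; apply: exp_e => g.
have := metric_triangle (Phi g x) (f g) (Phi g y).
by rewrite (metric_sym (f g)); have := shx g; have := shy g; lra.
Qed.

Lemma closed_preimage_closed_ball (R : realType) (T : topologicalType)
    (X : metricType R) (h : T -> X) (a : X) (c : R) :
  continuous h -> closed [set t | mdist a (h t) <= c].
Proof.
move=> h_cont t cl_t /=; apply/ler_addgt0Pr => r r0.
have [u [/= hu]] := cl_t _ (metricType_numDomainType.cvgr_dist_lt (h_cont t) r0).
rewrite metric_sym => tu; have := metric_triangle a (h u) (h t); lra.
Qed.

(** A cluster point of [F] inherits the closed conditions
    [mdist (Phi g x) (Phi g x') <= e] for all [g], so expansivity leaves only
    [x]; properness of [X] then turns this into convergence. *)
Lemma cvg_of_orbitwise_close (R : realType) (G : groupType) (X : metricType R)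
    (Phi : Act G X) (e : R) (F : set_system X) (x : X) :
  closed_balls_compact X -> 0 < e -> expansivity_constant Phi e ->
  ProperFilter F ->
  (forall g, \forall x' \near F, mdist (Phi g x) (Phi g x') <= e) ->
  F --> x.
Proof.
move=> X_proper e0 exp_e FF close.
have F_ball : F [set x' | mdist x x' <= e] by have := close 1%g; rewrite act1.
have cluster_sub : cluster F `<=` [set x].
  move=> z; rewrite clusterE => cl_z; apply/esym/exp_e => g.
  have [Phig_cont _] := act_homeo Phi g.
  exact/(closed_preimage_closed_ball Phig_cont)/cl_z/close.
apply: (compact_cluster_set1 _ (X_proper x e e0)) => //.
- exact: metric_hausdorff.
- apply/metricType_numDomainType.nbhs_mdistP.
  by exists e => //= z /= /ltW.
- apply/seteqP; split=> // _ ->.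
  have [z [_ Fz]] := X_proper x e e0 F FF F_ball.
  by rewrite -(cluster_sub z Fz).
Qed.

(** * Stability *)

Theorem theorem4p6 (R : realType) (G : groupType) (S : set G)
    (S_finite : finite_set S) (S_symmetric : symmetric_subset S)
    (S_generating : generating S)
    (X : metricType R) (X_proper : closed_balls_compact X)
    (Phi : Act G X) :
  expansive Phi -> shadowing S Phi -> strongly_GH_stable S Phi.
Proof.
move=> /expansive_constant[e e0 exp_e] shadow eps eps0.
(* Uniqueness of shadowing points needs [2 eta <= e]; continuity needs
   [2 eta + 2 delta <= e]; closeness to an isometry needs
   [delta + 2 eta < eps].  The bound [2 delta <= 1] keeps the truncation in
   [bdist] inactive. *)
pose eta := Num.min e eps / 4.
have [eta0 eta_e eta_eps] : [/\ 0 < eta, 4 * eta <= e & 4 * eta <= eps].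
  by rewrite /eta; case: (leP e eps) => ?; split; lra.
have [delta0 delta00 shadow_eta] := shadow _ eta0.
pose delta := Num.min delta0 (Num.min eta 2^-1).
have [delta_gt0 delta_le0 delta_eta delta1] :
    [/\ 0 < delta, delta <= delta0, delta <= eta & 2 * delta <= 1].
  split.
  - by rewrite !lt_min delta00 eta0 invr_gt0 ltr0n.
  - by rewrite ge_min lexx.
  - by rewrite !ge_min lexx orbT.
  - have : delta <= 2^-1 by rewrite !ge_min lexx !orbT.
    by lra.
exists delta => // Y Psi /GH_dist_lt[d [i [/andP[d0 d_delta] iso] defect]].
have shadowed y : exists x, forall g, mdist (Phi g x) (i (Psi g y)) < eta.
  apply: (shadow_eta (fun g => i (Psi g y))) => s g Ss.
  apply: (@lt_le_trans _ _ delta) => //.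
  apply: mdist_lt_of_bdist_lt; first by lra.
  by rewrite (actM Psi) /=; apply: lt_trans (defect _ _ Ss) d_delta.
have [k k_shadow] := choice shadowed.
exists k; split.
- move=> y; apply: (cvg_of_orbitwise_close X_proper e0 exp_e) => g.
  have [Psig_cont _] := act_homeo Psi g.
  have /(_ (nbhs_filter y)) :=
    metricType_numDomainType.cvgr_dist_lt (Psig_cont y) delta_gt0.
  rewrite near_simpl; apply: filterS => y' near_y' /=.
  have i_close : mdist (i (Psi g y)) (i (Psi g y')) < 2 * delta.
    apply: mdist_lt_of_bdist_lt => //.
    have := delta_isometry_distortion iso (Psi g y) (Psi g y').
    by rewrite ltr_norml => /andP[_]; have := bdist_le_mdist (Psi g y) (Psi g y');
      lra.
  have := metric_triangle (Phi g (k y)) (i (Psi g y)) (Phi g (k y')).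
  have := metric_triangle (i (Psi g y)) (i (Psi g y')) (Phi g (k y')).
  rewrite (metric_sym (i (Psi g y'))).
  by have := k_shadow y g; have := k_shadow y' g; lra.
- apply: (delta_isometry_perturb (ltW d0) (ltW eta0) _ iso); first by lra.
  by move=> y; have := k_shadow y 1%g; rewrite !act1 => /ltW.
- move=> h; apply/funext => y /=.
  have eta2_e : 2 * eta <= e by lra.
  apply: (shadowing_point_unique exp_e eta2_e _ (k_shadow (Psi h y))).
  by move=> g; have := k_shadow y (g * h)%g; rewrite !actM.
Qed.
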